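(* Let $d$ be a positive integer and let $G$ be a graph on $d+2$ vertices whose adjacency matrix $A_G$ has eigenvalues $\lambda_1 \geq \lambda_2 \geq \dots \geq \lambda_{d+2}$. Let $J$ be the $(d+2)\times(d+2)$ all-ones matrix and $P = I - \frac{1}{d+2}J$ the orthogonal projection onto the subspace orthogonal to the all-ones vector. Then $G$ has a spherical representation in $\mathbb{R}^d$ if and only if the maximum eigenvalue of $PA_GP$ equals $\lambda_2$ and the multiplicity of $\lambda_2$ as an eigenvalue of $A_G$ (excluding $\lambda_1$, i.e. counted one less, if $\lambda_1 = \lambda_2$) equals the multiplicity of $\lambda_2$ as an eigenvalue of $PA_GP$.
   Context: Graphs are finite and simple; $A_G$ is the adjacency matrix of $G$ and its eigenvalues are listed with multiplicity. A finite set $S \subset \mathbb{R}^d$ is a 2-distance set if the set $\{\|p-q\| : p,q \in S, p \neq q\}$ has exactly two elements $\alpha_1 > \alpha_2$; its distance ratio is $k = \alpha_1/\alpha_2 > 1$. The associated graph of $S$ has vertex set $S$, with $p,q$ adjacent iff $\|p-q\| = \alpha_1$. A graph $G$ is representable in $\mathbb{R}^d$ with ratio $k$ if there is a 2-distance set in $\mathbb{R}^d$ with distance ratio $k$ whose associated graph is $G$. $G$ has a spherical representation in $\mathbb{R}^d$ if there is such a 2-distance set $S \subset \mathbb{R}^d$ whose points all lie on a $(d-1)$-dimensional sphere in $\mathbb{R}^d$. *)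

(* Defs.v *)
From HB Require Import structures.
From mathcomp Require Import all_boot all_order all_algebra.
From mathcomp Require Import reals.
Set Implicit Arguments. Unset Strict Implicit. Unset Printing Implicit Defensive.
Import Order.TTheory GRing.Theory Num.Theory.
Local Open Scope ring_scope.

Section Defs.
Variable R : realType.

Definition simple_graph n (e : rel 'I_n) : Prop := symmetric e /\ irreflexive e.

Definition adj_mx n (e : rel 'I_n) : 'M[R]_n := \matrix_(i, j) (e i j)%:R.

Definition proj_ones n : 'M[R]_n := 1%:M - (n%:R)^-1 *: const_mx 1.

Definition spectrum_desc n (A : 'M[R]_n) (s : seq R) : Prop :=
  sorted (fun x y => y <= x) s /\ char_poly A = \prod_(x <- s) ('X - x%:P).

Definition eucl_dist d (u v : 'rV[R]_d) : R :=
  Num.sqrt (\sum_(k < d) (u 0 k - v 0 k) ^+ 2).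

Definition represents n d (e : rel 'I_n) (f : 'I_n -> 'rV[R]_d) : Prop :=
  injective f /\
  exists a1 a2 : R, a2 < a1 /\
    (forall x : R, (exists i j, i != j /\ eucl_dist (f i) (f j) = x)
                   <-> (x = a1 \/ x = a2)) /\
    (forall i j, i != j -> (e i j <-> eucl_dist (f i) (f j) = a1)).

Definition spherical_rep n d (e : rel 'I_n) : Prop :=
  exists f : 'I_n -> 'rV[R]_d, represents e f /\
    exists (c : 'rV[R]_d) (r : R), 0 < r /\ forall i, eucl_dist (f i) c = r.

End Defs.

(* Main.v *)
Require Import Defs.
From HB Require Import structures.
From mathcomp Require Import all_boot all_order all_algebra.
From mathcomp Require Import reals zify ring lra.
Import Order.TTheory GRing.Theory Num.Theory.
Local Open Scope ring_scope.

(** The Gram matrix about the centre of a spherical representation is, up to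
    scaling, [G = th I - A + s J] with [th = 1 / (k ^ 2 - 1) > 0]; conversely a
    positive semidefinite [G] of rank at most [d] factors as [F F^T] with [d]
    columns, and the rows of [F] are the points. So the question is whether some
    [th > 0] and [s] make [G] positive semidefinite with a kernel of dimension at
    least 2.

    If they do, the kernel meets the complement of the all-ones vector [1], which
    forces [th] to be the top eigenvalue of [P A P]; its eigenvectors are killed by
    [G], hence are exactly the [th]-eigenvectors of [A] orthogonal to [1].
    Interlacing gives [lam_2 <= th]. If [th < lam_1], every [th]-eigenvector of [A]
    is orthogonal to [1]; if [th = lam_1], a nonnegative (Perron) eigenvector is
    not, and one dimension is lost.

    Conversely let [th = lam_2] be the top eigenvalue of [P A P]. If
    [lam_1 = lam_2], take [s = 0]. Otherwise the multiplicity condition identifies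
    the two eigenspaces, so [1] is orthogonal to the kernel of [th I - A] and
    [1 = u (th I - A)] for some [u]; then [s = - 1 / (u . 1)] adds [u] to the
    kernel. *)

Set Implicit Arguments.
Unset Strict Implicit.

(** * The standard bilinear form on row vectors *)

Section Dot.
Variable R : comPzRingType.

Definition dot n (x y : 'rV[R]_n) : R := (x *m y^T) 0 0.

Lemma dotE n (x y : 'rV[R]_n) : dot x y = \sum_k x 0 k * y 0 k.
Proof. by rewrite /dot mxE; apply: eq_bigr => k _; rewrite !mxE. Qed.

Lemma mulmx_tr_dot n (x y : 'rV[R]_n) : x *m y^T = (dot x y)%:M.
Proof. by rewrite [LHS]mx11_scalar. Qed.

Lemma dotC n (x y : 'rV[R]_n) : dot x y = dot y x.
Proof. by rewrite !dotE; apply: eq_bigr => k _; rewrite mulrC. Qed.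

Lemma dotDl n (x y z : 'rV[R]_n) : dot (x + y) z = dot x z + dot y z.
Proof. by rewrite /dot mulmxDl mxE. Qed.

Lemma dotZl n a (x z : 'rV[R]_n) : dot (a *: x) z = a * dot x z.
Proof. by rewrite /dot -scalemxAl mxE. Qed.

Lemma dotNl n (x z : 'rV[R]_n) : dot (- x) z = - dot x z.
Proof. by rewrite -scaleN1r dotZl mulN1r. Qed.

Lemma dotBl n (x y z : 'rV[R]_n) : dot (x - y) z = dot x z - dot y z.
Proof. by rewrite dotDl dotNl. Qed.

Lemma dot0l n (z : 'rV[R]_n) : dot 0 z = 0.
Proof. by rewrite /dot mul0mx mxE. Qed.

Lemma dotDr n (x y z : 'rV[R]_n) : dot z (x + y) = dot z x + dot z y.
Proof. by rewrite dotC dotDl !(dotC z). Qed.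

Lemma dotZr n a (x z : 'rV[R]_n) : dot z (a *: x) = a * dot z x.
Proof. by rewrite dotC dotZl dotC. Qed.

Lemma dotNr n (x z : 'rV[R]_n) : dot z (- x) = - dot z x.
Proof. by rewrite dotC dotNl dotC. Qed.

Lemma dotBr n (x y z : 'rV[R]_n) : dot z (x - y) = dot z x - dot z y.
Proof. by rewrite dotDr dotNr. Qed.

Lemma dot_mulmxl m n (x : 'rV[R]_m) (A : 'M[R]_(m, n)) (y : 'rV[R]_n) :
  dot (x *m A) y = dot x (y *m A^T).
Proof. by rewrite /dot trmx_mul trmxK mulmxA. Qed.

Lemma dot_symmx n (A : 'M[R]_n) (x y : 'rV[R]_n) :
  A^T = A -> dot (x *m A) y = dot (y *m A) x.
Proof. by move=> sA; rewrite dot_mulmxl sA dotC. Qed.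

Lemma dot_row_mx m n (x z : 'rV[R]_m) (y t : 'rV[R]_n) :
  dot (row_mx x y) (row_mx z t) = dot x z + dot y t.
Proof. by rewrite /dot tr_row_mx mul_row_col mxE. Qed.

Definition dotl := (dotDl, dotBl, dotNl, dotZl, dot0l).
Definition dotr := (dotDr, dotBr, dotNr, dotZr).

End Dot.

(** * Positive semidefinite matrices and Householder reflections *)

Section Psd.
Variable R : realFieldType.

Lemma dot_ge0 n (x : 'rV[R]_n) : 0 <= dot x x.
Proof. by rewrite dotE sumr_ge0 // => k _; rewrite -expr2 sqr_ge0. Qed.

Lemma dot_eq0 n (x : 'rV[R]_n) : (dot x x == 0) = (x == 0).
Proof.
apply/eqP/eqP => [|->]; last by rewrite dot0l.
rewrite dotE => /psumr_eq0P x0; apply/rowP => k; rewrite mxE; apply/eqP.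
by rewrite -sqrf_eq0 expr2 x0 // => i _; rewrite -expr2 sqr_ge0.
Qed.

Lemma dot_gt0 n (x : 'rV[R]_n) : (0 < dot x x) = (x != 0).
Proof. by rewrite lt0r dot_eq0 dot_ge0 andbT. Qed.

Definition psd n (A : 'M[R]_n) := forall x : 'rV[R]_n, 0 <= dot (x *m A) x.

(* Expand the form at [t x + y] with [y = x A]: it is affine in [t]. *)
Lemma psd_ker n (A : 'M[R]_n) (x : 'rV[R]_n) :
  A^T = A -> psd A -> dot (x *m A) x = 0 -> x *m A = 0.
Proof.
move=> sA pA x0; apply/eqP; rewrite -dot_eq0; set y := x *m A.
apply/negPn/negP => ynz; have yy : 0 < dot y y by rewrite lt0r ynz dot_ge0.
(* [t] solves [2 t (y . y) + y A . y = -1], so the form would take the value [-1]. *)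
pose t := - (dot (y *m A) y + 1) / (2 * dot y y).
have := pA (t *: x + y).
rewrite mulmxDl -scalemxAl -/y !dotl !dotr [dot y x]x0 (dot_symmx y x sA) -/y.
have -> : t * (t * 0 + dot y y) + (t * dot y y + dot (y *m A) y) = -1.
  by rewrite /t; field; rewrite lt0r_neq0.
by rewrite ler0N1.
Qed.

(** The reflection in the hyperplane orthogonal to [v - w] swaps two vectors of equal length; for
    [v = w] the identity serves. *)
Lemma householder n (v w : 'rV[R]_n) : dot v v = dot w w ->
  exists H : 'M[R]_n, [/\ H^T = H, H *m H = 1%:M & w *m H = v].
Proof.
move=> vw; have [->|nvw] := eqVneq v w.
  by exists 1%:M; split; rewrite ?trmx1 ?mulmx1.
have [u uE] : exists u, u = v - w by exists (v - w).
pose c := 2 / dot u u.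
have u0 : dot u u != 0 by rewrite dot_eq0 uE subr_eq0.
exists (1%:M - c *: (u^T *m u)); split.
- by rewrite linearB linearZ /= trmx1 trmx_mul trmxK.
- rewrite mulmxBl mul1mx mulmxBr mulmx1 -scalemxAr -!scalemxAl.
  rewrite -mulmxA (mulmxA u) mulmx_tr_dot mul_scalar_mx -scalemxAr !scalerA.
  rewrite -addrA -opprD -scalerBl -scalerDl.
  have -> : c + (c - c * c * dot u u) = 0 by rewrite /c; field.
  by rewrite scale0r subr0.
- rewrite mulmxBr mulmx1 -scalemxAr mulmxA mulmx_tr_dot mul_scalar_mx scalerA.
  have -> : c * dot w u = -1.
    have e : dot u u = - 2 * dot w u.
      by rewrite uE !dotl !dotr vw (dotC v w); ring.
    move: u0; rewrite /c e => u0; field.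
    by apply: contraNneq u0 => ->; rewrite mulr0.
  by rewrite scaleN1r opprK uE addrC subrK.
Qed.
End Psd.

(** * Spectra of symmetric matrices, by deflation *)

Section SymmetricSpectrum.
Variable R : rcfType.

Lemma unit_eigenvector n (A : 'M[R]_n) a : eigenvalue A a ->
  exists2 v : 'rV[R]_n, v *m A = a *: v & dot v v = 1.
Proof.
case/eigenvalueP => v vA v0; have vv : 0 < dot v v by rewrite dot_gt0.
exists ((Num.sqrt (dot v v))^-1 *: v); first by rewrite -scalemxAl vA !scalerA mulrC.
rewrite dotZl dotZr mulrA -invfM -expr2 sqr_sqrtr ?ltW //.
by rewrite mulVf ?gt_eqF.
Qed.

(** A reflection exchanging a unit eigenvector and the first basis vector puts [a] in the corner;
    symmetry clears the rest of the first row and column. *)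
Lemma symmx_deflate n (A : 'M[R]_(1 + n)) a : A^T = A -> eigenvalue A a ->
  exists (H : 'M[R]_(1 + n)) (B : 'M[R]_n),
    [/\ H^T = H, H *m H = 1%:M, B^T = B &
        A = H *m block_mx a%:M 0 0 B *m H].
Proof.
move=> sA /unit_eigenvector[v vA v1].
pose e : 'rV[R]_(1 + n) := row_mx 1%:M 0.
have e1 : dot e e = 1.
  by rewrite /dot tr_row_mx mul_row_col trmx1 mulmx1 mul0mx addr0 mxE.
have [H [sH HH eH]] := householder (etrans v1 (esym e1)).
pose C := H *m A *m H.
have sC : C^T = C by rewrite !trmx_mul sA sH mulmxA.
have eC : e *m C = a *: e.
  by rewrite !mulmxA eH vA -scalemxAl -eH -mulmxA HH mulmx1.
exists H, (drsubmx C); split=> //; first by rewrite trmx_drsub sC.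
have rC : row_mx (ulsubmx C) (ursubmx C) = row_mx a%:M 0.
  move: eC; rewrite -{1}[C]submxK mul_row_block !mul1mx !mul0mx !addr0 => ->.
  by rewrite scale_row_mx scaler0 scale_scalar_mx mulr1.
have [ul ur] := eq_row_mx rC.
have dl : dlsubmx C = 0 by rewrite -[LHS]trmxK trmx_dlsub sC ur trmx0.
rewrite -ul -{1}ur -dl submxK /C !mulmxA HH mul1mx -mulmxA HH mulmx1 //.
Qed.

Lemma conj_invol_char_poly n (H A : 'M[R]_n) :
  H *m H = 1%:M -> char_poly (H *m A *m H) = char_poly A.
Proof.
move=> HH; rewrite /char_poly.
have -> : char_poly_mx (H *m A *m H)
    = map_mx polyC H *m char_poly_mx A *m map_mx polyC H.
  rewrite /char_poly_mx !map_mxM mulmxBr mulmxBl; congr (_ - _).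
  by rewrite mul_mx_scalar -scalemxAl -map_mxM HH map_mx1 scalemx1.
rewrite !det_mulmx mulrAC -det_mulmx -map_mxM HH map_mx1 det1 mul1r //.
Qed.

(** The smaller block inherits the remaining roots, so facts about the whole spectrum follow by
    peeling off one root at a time. *)
Lemma symmx_deflate_char_poly n (A : 'M[R]_(1 + n)) a s : A^T = A ->
  char_poly A = \prod_(x <- a :: s) ('X - x%:P) ->
  exists (H : 'M[R]_(1 + n)) (B : 'M[R]_n),
    [/\ H^T = H, H *m H = 1%:M, B^T = B,
        A = H *m block_mx a%:M 0 0 B *m H
      & char_poly B = \prod_(x <- s) ('X - x%:P)].
Proof.
move=> sA cA; have ev : eigenvalue A a.
  by rewrite eigenvalue_root_char cA root_prod_XsubC mem_head.
have [H [B [sH HH sB AE]]] := symmx_deflate sA ev.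
exists H, B; split=> //; move: cA.
rewrite {1}AE conj_invol_char_poly // /char_poly char_block_diag_mx det_ublock.
rewrite -/(char_poly B) big_cons.
have -> : \det (char_poly_mx a%:M : 'M[{poly R}]_1) = 'X - a%:P.
  by rewrite det_mx11 !mxE.
by apply: mulfI; rewrite polyXsubC_eq0.
Qed.

Lemma rank_conj_invol n (H A : 'M[R]_n) :
  H *m H = 1%:M -> \rank (H *m A *m H) = \rank A.
Proof.
move=> HH; have [uH _] := mulmx1_unit HH.
by rewrite mxrankMfree ?row_free_unit // -mxrank_tr trmx_mul mxrankMfree
  ?row_free_unit ?unitmx_tr // mxrank_tr.
Qed.

(** Algebraic and geometric multiplicities agree: each root [b] contributes a block [b - a], of rank
    0 exactly when [b = a]. *)
Lemma symmx_multiplicity n (A : 'M[R]_n) s a : A^T = A ->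
  char_poly A = \prod_(x <- s) ('X - x%:P) ->
  (\rank (A - a%:M)%R + count (pred1 a) s)%N = n.
Proof.
move=> sA cA; have ss : size s = n.
  by have := size_char_poly A; rewrite cA size_prod_XsubC => -[].
elim: n s ss A sA cA => [|n IH] [|b s] //= ss A sA cA.
  by rewrite flatmx0 mxrank0.
have [H [B [sH HH sB AE cB]]] := @symmx_deflate_char_poly n A b s sA cA.
case: ss => ss; have := IH s ss B sB cB.
have -> : A - a%:M = H *m block_mx (b - a)%:M 0 0 (B - a%:M) *m H.
  transitivity (H *m (block_mx b%:M 0 0 B - a%:M) *m H).
    rewrite mulmxBr mulmxBl -AE; congr (_ - _).
    by rewrite mul_mx_scalar -scalemxAl HH scalemx1.
  rewrite (@scalar_mx_block _ 1 n a) opp_block_mx add_block_mx !oppr0 !addr0.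
  by rewrite raddfB.
rewrite (@rank_conj_invol (1 + n)) // rank_diag_block_mx.
have -> : \rank ((b - a)%R%:M : 'M[R]_1) = (b != a).
  by rewrite rank_rV -scalemx1 scaler_eq0 oner_eq0 orbF subr_eq0.
by case: (b =P a) => /= _; lia.
Qed.

(** Rayleigh's bound: after deflation the form splits into [b] times the square of one coordinate
    and the form of the smaller block. *)
Lemma symmx_form_le n (A : 'M[R]_n) s c : A^T = A ->
  char_poly A = \prod_(x <- s) ('X - x%:P) -> {in s, forall x, x <= c} ->
  forall x : 'rV[R]_n, dot (x *m A) x <= c * dot x x.
Proof.
move=> sA cA; have ss : size s = n.
  by have := size_char_poly A; rewrite cA size_prod_XsubC => -[].
elim: n s ss A sA cA => [|n IH] [|b s] //= ss A sA cA sc x.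
  by rewrite thinmx0 !dotE !big_ord0 mulr0.
have [H [B [sH HH sB AE cB]]] := @symmx_deflate_char_poly n A b s sA cA.
case: ss => ss; have {}IH := IH s ss B sB cB.
have -> : dot x x = dot (x *m H) (x *m H).
  by rewrite dot_mulmxl sH -mulmxA HH mulmx1.
rewrite AE 2!mulmxA dot_mulmxl sH; move: (x *m H) => {x} y.
rewrite -[y](@hsubmxK _ 1 1 n) mul_row_block !mulmx0 addr0 add0r.
rewrite !dot_row_mx mulrDr lerD //.
  rewrite mul_mx_scalar dotZl ler_wpM2r ?dot_ge0 // sc ?mem_head //.
by apply: IH => z zs; apply: sc; rewrite inE zs orbT.
Qed.
End SymmetricSpectrum.

(** * Positive semidefinite matrices as Gram matrices *)

Section GramFactorization.
Variable R : rcfType.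

Lemma dot_delta n (x : 'rV[R]_n) i : dot x (delta_mx 0 i) = x 0 i.
Proof.
rewrite dotE (bigD1 i) //= big1 ?mxE ?eqxx ?mulr1 ?addr0 // => j /negPf ji.
by rewrite mxE ji andbF mulr0.
Qed.

(** If [A i i] is 0, the basis vector [i] is isotropic and [psd_ker] makes row [i] vanish. *)
Lemma psd_diag_neq0 n (A : 'M[R]_n) :
  A^T = A -> psd A -> A != 0 -> exists i, 0 < A i i.
Proof.
move=> sA pA A0; apply/existsP; apply: contraNT A0 => /existsPn Aii.
apply/eqP/row_matrixP => i; rewrite row0 rowE; apply: psd_ker => //.
apply/eqP; rewrite eq_le pA andbT dot_delta -rowE mxE leNgt.
exact: Aii.
Qed.

(* Split off the rank one matrix [g^T g / A i i], where [g] is row [i]; by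
   completing the square the remainder is still positive semidefinite, and its
   kernel acquires the basis vector [i]. *)
Lemma psd_factor n d (A : 'M[R]_n) : A^T = A -> psd A -> (\rank A <= d)%N ->
  exists F : 'M[R]_(n, d), A = F *m F^T.
Proof.
elim: d A => [|d IH] A sA pA rA.
  exists 0; rewrite mul0mx; apply/eqP; rewrite -mxrank_eq0; lia.
have [->|A0] := eqVneq A 0; first by exists 0; rewrite mul0mx.
have [i a0] := psd_diag_neq0 sA pA A0; set a := A i i in a0.
have an0 : a != 0 by rewrite gt_eqF.
pose e : 'rV[R]_n := delta_mx 0 i.
have [g gE] : exists g, g = e *m A by exists (e *m A).
have ge : dot g e = a by rewrite gE dot_delta -rowE mxE.
pose B := A - a^-1 *: (g^T *m g).
have sB : B^T = B by rewrite linearB linearZ /= trmx_mul trmxK sA.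
have xB x : x *m B = x *m A - (a^-1 * dot x g) *: g.
  rewrite mulmxBr -scalemxAr mulmxA mulmx_tr_dot mul_scalar_mx scalerA //.
have pB : psd B.
  move=> x; rewrite xB !dotl (dotC g x).
  (* [t] minimises the form of [A] along [x - t e], and the minimum is the form of [B] at [x]. *)
  pose t := dot x g / a; have := pA (x - t *: e).
  rewrite mulmxBl -scalemxAl -gE !dotl !dotr ge (dotC g x).
  have -> : dot (x *m A) e = dot x g by rewrite (dot_symmx x e sA) -gE dotC.
  by congr (_ <= _); rewrite /t; field.
have [|F BF] := IH B sB pB.
  suff : (kermx A < kermx B)%MS.
    by move/rank_ltmx; rewrite !mxrank_ker; have := rank_leq_row B; lia.
  apply/andP; split.
    apply/sub_kermxP; have -> : B = A *m (1%:M - a^-1 *: (e^T *m g)).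
      by rewrite /B mulmxBr mulmx1 -scalemxAr mulmxA {1}gE trmx_mul sA.
    by rewrite mulmxA mulmx_ker mul0mx.
  have eB : (e <= kermx B)%MS.
    by apply/sub_kermxP; rewrite xB -gE (dotC e) ge mulVf // scale1r subrr.
  apply: contra an0 => /(submx_trans eB)/sub_kermxP eA.
  by rewrite -ge gE eA dot0l.
pose G : 'M[R]_(n, 1 + d) := row_mx ((Num.sqrt a)^-1 *: g^T) F.
suff AG : A = G *m G^T by exists G.
rewrite tr_row_mx mul_row_col -BF linearZ /= trmxK -scalemxAl -scalemxAr scalerA.
by rewrite -invfM -expr2 sqr_sqrtr ?ltW // addrC subrK.
Qed.

Lemma psd_mulmx_tr n d (F : 'M[R]_(n, d)) : psd (F *m F^T).
Proof. by move=> x; rewrite mulmxA dot_mulmxl trmxK dot_ge0. Qed.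

Lemma psdZ n a (A : 'M[R]_n) : 0 <= a -> psd A -> psd (a *: A).
Proof. by move=> a0 pA x; rewrite -scalemxAr dotZl mulr_ge0. Qed.

End GramFactorization.

(** * Spherical representations and their Gram matrices *)

Section SphericalGram.
Variable R : realType.

(* Up to scaling, the Gram matrix about the centre of a spherical
   representation: [th] is [1 / (k ^ 2 - 1)] for the distance ratio [k], and [s]
   encodes the radius. *)
Definition spherical_gram n (A : 'M[R]_n) th s : 'M[R]_n :=
  th%:M - A + s *: const_mx 1.

Lemma eucl_distE d (u v : 'rV[R]_d) :
  eucl_dist u v = Num.sqrt (dot (u - v) (u - v)).
Proof.
by rewrite /eucl_dist dotE; congr Num.sqrt; apply: eq_bigr => k _; rewrite !mxE.
Qed.

Lemma eucl_dist_sqr d (u v : 'rV[R]_d) :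
  eucl_dist u v ^+ 2 = dot (u - v) (u - v).
Proof. by rewrite eucl_distE sqr_sqrtr ?dot_ge0. Qed.

Lemma spherical_rep_gram d (e : rel 'I_d.+2) : simple_graph e ->
  spherical_rep R d e ->
  exists th s, [/\ 0 < th, psd (spherical_gram (adj_mx R e) th s)
    & (\rank (spherical_gram (adj_mx R e) th s) <= d)%N].
Proof.
move=> [_ eI] [f [[fI [a1 [a2 [a21 [dist edist]]]]] [c [r [r0 fr]]]]].
have a20 : 0 < a2.
  have [i [j [ij <-]]] : exists i j, i != j /\ eucl_dist (f i) (f j) = a2.
    by apply/dist; right.
  rewrite eucl_distE sqrtr_gt0 dot_gt0 subr_eq0.
  by apply: contraNneq ij => /fI ->.
(* An edge lowers the inner product about [c] by this amount, so dividing by [k] gives [A] the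
   coefficient [-1]; this [k] is not the distance ratio. *)
pose k := (a1 ^+ 2 - a2 ^+ 2) / 2.
have k0 : 0 < k by rewrite /k; nra.
have a1E : a1 ^+ 2 = a2 ^+ 2 + 2 * k by rewrite /k; field.
have kn0 : k != 0 by rewrite gt_eqF.
pose F : 'M[R]_(d.+2, d) := \matrix_i (f i - c).
have FE i j : (F *m F^T) i j = dot (f i - c) (f j - c).
  by rewrite mxE dotE; apply: eq_bigr => l _; rewrite !mxE.
pose th := a2 ^+ 2 / 2 / k; pose s := (r ^+ 2 - a2 ^+ 2 / 2) / k.
have gE : spherical_gram (adj_mx R e) th s = k^-1 *: (F *m F^T).
  apply/matrixP => i j; rewrite [RHS]mxE FE !mxE.
  have fii l : dot (f l - c) (f l - c) = r ^+ 2 by rewrite -eucl_dist_sqr fr.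
  have [<-|ij] := eqVneq i j.
    by rewrite fii eI /= /th /s; field.
  have -> : dot (f i - c) (f j - c) = r ^+ 2 - eucl_dist (f i) (f j) ^+ 2 / 2.
    have -> : eucl_dist (f i) (f j) ^+ 2
        = dot ((f i - c) - (f j - c)) ((f i - c) - (f j - c)).
      by rewrite eucl_dist_sqr opprB addrA subrK.
    move: (f i - c) (f j - c) (fii i) (fii j) => x y xx yy.
    by rewrite !dotl !dotr xx yy (dotC y x); field.
  rewrite /= mulr0n /s; have [eij|eij] := boolP (e i j).
    by rewrite (proj1 (edist i j ij) eij) a1E /=; field.
  have -> : eucl_dist (f i) (f j) = a2.
    have /dist[] // : exists i' j', i' != j' /\ eucl_dist (f i') (f j') = eucl_dist (f i) (f j).
      by exists i, j.
    by move/(proj2 (edist i j ij)); rewrite (negPf eij).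
  by rewrite /=; field.
exists th, s; split.
- by apply: divr_gt0 => //; apply: divr_gt0; rewrite ?exprn_gt0 ?ltr0n.
- by rewrite gE; apply: psdZ; [rewrite invr_ge0 ltW | exact: psd_mulmx_tr].
- rewrite gE (leq_trans (mxrank_scale _ _)) // (leq_trans (mxrankM_maxl _ _)) //.
  by rewrite rank_leq_col.
Qed.

(** The rows of the factor [F] are the points; an edge and a non-edge ensure that both distances
    occur. *)
Lemma gram_spherical_rep d (e : rel 'I_d.+2) th s : simple_graph e ->
  0 < th -> (exists i j, e i j) -> (exists i j, i != j /\ ~~ e i j) ->
  psd (spherical_gram (adj_mx R e) th s) ->
  (\rank (spherical_gram (adj_mx R e) th s) <= d)%N ->
  spherical_rep R d e.
Proof.
move=> [eS eI] th0 [i1 [j1 e1]] [i2 [j2 [n2 e2]]]; set M := spherical_gram _ _ _.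
have sM : M^T = M.
  apply/matrixP => i j; rewrite !mxE eS eq_sym //.
move=> pM rM; have [F MF] := psd_factor sM pM rM.
have FE i j : dot (row i F) (row j F) = M i j.
  by rewrite MF mxE dotE; apply: eq_bigr => l _; rewrite !mxE.
have FB i j : i != j ->
    dot (row i F - row j F) (row i F - row j F) = 2 * th + 2 * (e i j)%:R.
  move=> ij; rewrite !dotl !dotr !FE !mxE !eqxx !eI (eq_sym j) (negPf ij).
  by rewrite (eS j i) /= mulr1n mulr0n; ring.
have dE i j : i != j -> eucl_dist (row i F) (row j F)
    = Num.sqrt (2 * th + 2 * (e i j)%:R).
  by move=> ij; rewrite eucl_distE FB.
have lt12 : Num.sqrt (2 * th) < Num.sqrt (2 * th + 2 * 1).
  by rewrite ltr_sqrt; lra.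
have fI : injective (fun i => row i F).
  move=> i j /= ij; apply/eqP; apply: contraTT isT => /FB.
  by rewrite ij subrr dot0l; case: (e i j) => /=; lra.
exists (fun i => row i F); split.
  split=> //; exists (Num.sqrt (2 * th + 2 * 1)), (Num.sqrt (2 * th)).
  split=> //; split=> [x|i j ij]; first split.
  - move=> [i [j [ij <-]]]; rewrite dE //.
    by case: (e i j) => /=; [left | right; rewrite mulr0 addr0].
  - case=> ->.
      exists i1, j1; have n1 : i1 != j1 by apply: contraTneq e1 => ->; rewrite eI.
      by rewrite dE // e1.
    by exists i2, j2; rewrite dE // (negPf e2) mulr0 addr0.
  - rewrite dE //; case: (e i j); first by split.
    by rewrite mulr0 addr0; split=> // h; move: lt12; rewrite h ltxx.
exists 0, (Num.sqrt (th + s)).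
have Fii i : dot (row i F) (row i F) = th + s.
  by rewrite FE !mxE eqxx eI /= mulr1 subr0.
split; last by move=> i; rewrite eucl_distE subr0 Fii.
(* All rows have the same norm, so one zero row would make them all zero, against injectivity. *)
rewrite sqrtr_gt0 -(Fii ord0) dot_gt0; apply/eqP => F0.
have : row ord_max F = 0.
  by apply/eqP; rewrite -dot_eq0 Fii -(Fii ord0) F0 dot0l.
by rewrite -F0 => /fI /(congr1 val).
Qed.
End SphericalGram.

(** * Eigenvalue lists and dimensions of eigenspaces *)

Section Spectra.
Variable R : realType.

(** Turns the list counts of the criterion into dimensions. *)
Lemma count_rank_eigenspace n (A : 'M[R]_n) s a : A^T = A ->
  spectrum_desc A s -> count (pred1 a) s = \rank (eigenspace A a).
Proof.
move=> sA [_ cA]; apply: (@addnI (\rank (A - a%:M)%R)).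
by rewrite symmx_multiplicity // mxrank_ker subnKC // rank_leq_row.
Qed.

Lemma mem_spectrum n (A : 'M[R]_n) s a :
  spectrum_desc A s -> (a \in s) = eigenvalue A a.
Proof. by move=> [_ cA]; rewrite eigenvalue_root_char cA root_prod_XsubC. Qed.

Lemma spectrum_split n (A : 'M[R]_n.+2) s : spectrum_desc A s ->
  exists a b t, [/\ s = [:: a, b & t], b <= a & {in t, forall x, x <= b}].
Proof.
move=> [srt cA]; have ss : size s = n.+2.
  by have := size_char_poly A; rewrite cA size_prod_XsubC => -[].
case: s ss srt {cA} => [|a [|b t]] //= _ /andP[ba pt]; exists a, b, t; split=> //.
have tr : transitive (fun x y : R => y <= x).
  by move=> y x z yx zy; exact: le_trans zy yx.
by move=> x; move/allP: (order_path_min tr pt); exact.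
Qed.

Lemma spectrum_head n (A : 'M[R]_n.+2) s : spectrum_desc A s ->
  eigenvalue A s`_0 /\ {in s, forall x, x <= s`_0}.
Proof.
move=> sp; have [a [b [t [sE ba tb]]]] := spectrum_split sp.
rewrite -(mem_spectrum _ sp) sE mem_head; split=> // x.
by rewrite !inE => /or3P[/eqP->|/eqP->|/tb/le_trans->].
Qed.

Lemma spectrum_second n (A : 'M[R]_n.+2) s : spectrum_desc A s ->
  [/\ eigenvalue A s`_1, s`_1 <= s`_0 &
    {in s, forall x, x = s`_0 \/ x <= s`_1}].
Proof.
move=> sp; have [a [b [t [sE ba tb]]]] := spectrum_split sp.
rewrite -(mem_spectrum _ sp) sE !inE eqxx orbT; split=> // x.
by rewrite !inE => /or3P[/eqP->|/eqP->|/tb]; [left | right | right].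
Qed.

Lemma spectrum_top_multiple n (A : 'M[R]_n.+2) s : spectrum_desc A s ->
  (1 < count (pred1 (s`_0)%R) s)%N = (s`_0 == s`_1).
Proof.
move=> sp; have [a [b [t [sE ba tb]]]] := spectrum_split sp.
rewrite sE /= eqxx; have [->|nab] /= := eqVneq a b; first by rewrite ?eqxx.
rewrite add0n.
have /count_memPn -> : a \notin t; last by [].
by apply/negP => /tb ab; move: nab; rewrite eq_le ab ba.
Qed.

(** By rank-nullity: the functional [x . w] on the row space of [E] has rank at most 1. *)
Lemma rank2_orthogonal m n (E : 'M[R]_(m, n)) (w : 'rV[R]_n) :
  (1 < \rank E)%N -> exists x : 'rV[R]_n, [/\ x != 0, (x <= E)%MS & dot x w = 0].
Proof.
move=> rE.
have : (E :&: kermx w^T)%MS != 0.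
  rewrite -mxrank_eq0; apply: contraTN rE => /eqP r0.
  by rewrite -leqNgt -(mxrank_mul_ker E w^T) r0 addn0 rank_leq_col.
rewrite -nz_row_eq0 => nz; exists (nz_row (E :&: kermx w^T)%MS); split=> //.
  by apply: submx_trans (nz_row_sub _) _; exact: capmxSl.
have : (nz_row (E :&: kermx w^T)%MS <= kermx w^T)%MS.
  by apply: submx_trans (nz_row_sub _) _; exact: capmxSr.
by move/sub_kermxP; rewrite /dot => ->; rewrite mxE.
Qed.

Lemma sub_kermx_dot n (x w : 'rV[R]_n) :
  (x <= kermx w^T)%MS = (dot x w == 0).
Proof.
by rewrite sub_kermx mulmx_tr_dot -scalemx1 scaler_eq0 oner_eq0 orbF.
Qed.

(** The row space of a symmetric matrix is the orthogonal complement of its kernel. *)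
Lemma symmx_orthogonal_ker n (A : 'M[R]_n) (w : 'rV[R]_n) : A^T = A ->
  (kermx A <= kermx w^T)%MS -> exists u, u *m A = w.
Proof.
move=> sA kw; suff /submxP[u uA] : (w <= A)%MS by exists u.
rewrite submxE; apply/eqP; apply: trmx_inj; rewrite trmx_mul trmx0.
apply/sub_kermxP; apply: submx_trans kw; apply/sub_kermxP.
by rewrite -{2}sA -trmx_mul mulmx_coker trmx0.
Qed.

End Spectra.

(** * The all-ones vector and the compression [P A P] *)

Section Ones.
Variables (R : realType) (d : nat).
Local Notation n := d.+2.
Local Notation one := (const_mx 1 : 'rV[R]_n).
Local Notation P := (proj_ones R n).

Lemma mulmx_ones (x : 'rV[R]_n) :
  x *m (const_mx 1 : 'M[R]_n) = dot x (const_mx 1) *: const_mx 1.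
Proof.
apply/rowP => j; rewrite !mxE dotE mulr1.
by apply: eq_bigr => k _; rewrite !mxE.
Qed.

Lemma dot_ones_gt0 : 0 < dot one one.
Proof.
rewrite dot_gt0; apply/eqP => /rowP/(_ ord0); rewrite !mxE => /eqP.
by rewrite oner_eq0.
Qed.

Lemma proj_ones_sym : P^T = P.
Proof. by apply/matrixP => i j; rewrite !mxE eq_sym. Qed.

Lemma mulmx_proj_ones (x : 'rV[R]_n) :
  x *m P = x - (n%:R^-1 * dot x one) *: one.
Proof. by rewrite mulmxBr mulmx1 -scalemxAr mulmx_ones scalerA. Qed.

Lemma mulmx_proj_ones_id (x : 'rV[R]_n) : dot x one = 0 -> x *m P = x.
Proof. by move=> x1; rewrite mulmx_proj_ones x1 mulr0 scale0r subr0. Qed.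

Lemma ones_proj_ones : one *m P = 0.
Proof.
rewrite mulmx_proj_ones; have -> : dot one one = n%:R.
  rewrite dotE (eq_bigr (fun=> 1)) ?sumr_const ?card_ord // => k _.
  by rewrite !mxE mulr1.
by rewrite mulVf ?pnatr_eq0 // scale1r subrr.
Qed.

Lemma dot_proj_ones (x : 'rV[R]_n) : dot (x *m P) one = 0.
Proof. by rewrite dot_mulmxl proj_ones_sym ones_proj_ones dotC dot0l. Qed.

Variables (A : 'M[R]_n) (sA : A^T = A).
Local Notation B := (P *m A *m P).

Lemma proj_conj_sym : B^T = B.
Proof. by rewrite !trmx_mul sA proj_ones_sym mulmxA. Qed.

Lemma mulmx_proj_conj (x : 'rV[R]_n) :
  dot x one = 0 -> x *m B = x *m A *m P.
Proof. by move=> x1; rewrite !mulmxA (mulmx_proj_ones_id x1). Qed.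

Lemma dot_proj_conj (x : 'rV[R]_n) :
  dot x one = 0 -> dot (x *m B) x = dot (x *m A) x.
Proof.
move=> x1; rewrite mulmx_proj_conj // dot_mulmxl proj_ones_sym.
by rewrite mulmx_proj_ones_id.
Qed.

(** The image of [P A P] is orthogonal to [one], and it contains [x] because [th] is invertible. *)
Lemma proj_conj_eigen_ones (x : 'rV[R]_n) th :
  th != 0 -> x *m B = th *: x -> dot x one = 0.
Proof.
move=> th0 xB; apply/eqP; have : th * dot x one = 0.
  by rewrite -dotZl -xB mulmxA dot_proj_ones.
by move/eqP; rewrite mulf_eq0 (negPf th0).
Qed.

Lemma spherical_gram_sym th s : (spherical_gram A th s)^T = spherical_gram A th s.
Proof. by rewrite !linearD linearN linearZ /= tr_scalar_mx trmx_const sA. Qed.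

Lemma mulmx_spherical_gram (x : 'rV[R]_n) th s :
  x *m spherical_gram A th s = th *: x - x *m A + (s * dot x one) *: one.
Proof.
by rewrite mulmxDr mulmxBr mul_mx_scalar -scalemxAr mulmx_ones scalerA.
Qed.

(* Otherwise [(v.1) w - (w.1) v] would be orthogonal to [1] and violate the
   bound. *)
Lemma eigenvector_orthogonal_ones t a (v w : 'rV[R]_n) :
  (forall x, dot x one = 0 -> dot (x *m A) x <= t * dot x x) ->
  t < a -> w != 0 -> w *m A = a *: w -> v *m A = t *: v -> dot v one = 0.
Proof.
move=> le_t ta w0 wA vA; apply/eqP; apply: contraTT isT => v1.
have wv : dot w v = 0.
  have : (a - t) * dot w v = 0.
    by rewrite mulrBl -dotZl -wA -dotZr -vA (dot_symmx w v sA) dotC subrr.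
  by move/eqP; rewrite mulf_eq0 subr_eq0 gt_eqF //= => /eqP.
pose x := dot v one *: w - dot w one *: v.
have x1 : dot x one = 0 by rewrite !dotl mulrC subrr.
(* The terms in [v . v] cancel, leaving [(a - t) (v . one) ^ 2 (w . w) <= 0]. *)
have := le_t x x1.
rewrite mulmxBl -!scalemxAl wA vA !dotl !dotr (dotC v w) wv.
have w_gt0 : 0 < dot w w by rewrite dot_gt0.
have v_gt0 : 0 < dot v one ^+ 2 by rewrite lt0r sqrf_eq0 v1 sqr_ge0.
have : 0 < (a - t) * (dot v one ^+ 2 * dot w w).
  by rewrite mulr_gt0 ?subr_gt0 // mulr_gt0.
by move: (dot v v) (dot v one) (dot w w) (dot w one) => p q r z; lra.
Qed.

Hypothesis A_ge0 : forall i j, 0 <= A i j.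

(* If [v] maximises the Rayleigh quotient of a nonnegative matrix, so does its
   entrywise absolute value. *)
Lemma perron_ones th (v : 'rV[R]_n) :
  (forall x, dot (x *m A) x <= th * dot x x) -> v != 0 -> v *m A = th *: v ->
  exists2 u : 'rV[R]_n, u *m A = th *: u & dot u one != 0.
Proof.
move=> le_th v0 vA; pose u : 'rV[R]_n := \row_i `|v 0 i|.
have uu : dot u u = dot v v.
  by rewrite !dotE; apply: eq_bigr => i _; rewrite mxE -normrM ger0_norm // -expr2 sqr_ge0.
have sN : (th%:M - A)^T = th%:M - A by rewrite linearB /= tr_scalar_mx sA.
have NE x : x *m (th%:M - A) = th *: x - x *m A by rewrite mulmxBr mul_mx_scalar.
have pN : psd (th%:M - A) by move=> x; rewrite NE !dotl subr_ge0.
exists u.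
  apply/eqP; rewrite eq_sym -subr_eq0 -NE; apply/eqP; apply: psd_ker => //.
  apply/eqP; rewrite eq_le pN andbT NE !dotl subr_le0 uu -dotZl -vA.
  rewrite !dotE; apply: ler_sum => i _; rewrite !mxE !mulr_suml.
  apply: ler_sum => j _; rewrite !mxE.
  apply: le_trans (ler_norm _) _; rewrite !normrM (ger0_norm (A_ge0 _ _)) //.
have ui i : 0 <= u 0 i by rewrite mxE normr_ge0.
rewrite dotE; apply: contra v0 => /eqP/psumr_eq0P u0.
apply/eqP/rowP => i; apply/eqP; rewrite [X in _ == X]mxE -normr_eq0.
have := u0 _ i isT; rewrite !mxE mulr1 => -> // j _.
by rewrite mulr_ge0 ?ui // mxE ler01.
Qed.

End Ones.

(** * From a Gram matrix to the spectral conditions *)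

Section SpectralCriterion.
Variables (R : realType) (d : nat) (A : 'M[R]_d.+2).
Local Notation n := d.+2.
Local Notation one := (const_mx 1 : 'rV[R]_n).
Local Notation P := (proj_ones R n).
Local Notation B := (P *m A *m P).
Hypothesis sA : A^T = A.
Variables lam mu : seq R.
Hypothesis hlam : spectrum_desc A lam.
Hypothesis hmu : spectrum_desc B mu.

Let sB : B^T = B. Proof. exact: proj_conj_sym. Qed.

Lemma form_le_proj_top x :
  dot x one = 0 -> dot (x *m A) x <= mu`_0 * dot x x.
Proof.
move=> x1; rewrite -dot_proj_conj //.
exact: symmx_form_le sB (proj2 hmu) (proj2 (spectrum_head hmu)) x.
Qed.

Lemma form_le_top x : dot (x *m A) x <= lam`_0 * dot x x.
Proof. exact: symmx_form_le sA (proj2 hlam) (proj2 (spectrum_head hlam)) x. Qed.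

Lemma ones_proj_conj : one *m B = 0.
Proof. by rewrite !mulmxA ones_proj_ones !mul0mx. Qed.

Lemma proj_top_ge0 : 0 <= mu`_0.
Proof.
have := symmx_form_le sB (proj2 hmu) (proj2 (spectrum_head hmu)) one.
by rewrite ones_proj_conj dot0l pmulr_lge0 // dot_ones_gt0.
Qed.

Lemma eigen_proj_conj th (x : 'rV[R]_n) :
  dot x one = 0 -> x *m A = th *: x -> x *m B = th *: x.
Proof.
by move=> x1 xA; rewrite mulmx_proj_conj // xA -scalemxAl mulmx_proj_ones_id.
Qed.

(* The easy half of Cauchy interlacing. *)
Lemma second_le_form t :
  (forall x, dot x one = 0 -> dot (x *m A) x <= t * dot x x) -> lam`_1 <= t.
Proof.
move=> le_t; have [ev1 le10 _] := spectrum_second hlam.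
rewrite leNgt; apply/negP => t1.
suff [x [x0 xA x1]] : exists x : 'rV[R]_n,
    [/\ x != 0, x *m A = lam`_1 *: x & dot x one = 0].
  have := le_t x x1; rewrite xA dotZl ler_pM2r ?dot_gt0 //.
  by rewrite leNgt t1.
(* A multiple top eigenvalue has an eigenspace of dimension at least 2, which meets the complement
   of [one]. *)
have [e01|n01] := eqVneq lam`_0 lam`_1.
  have rE : (1 < \rank (eigenspace A lam`_1))%N.
    by rewrite -(count_rank_eigenspace _ sA hlam) -e01 (spectrum_top_multiple hlam) e01.
  have [x [x0 /eigenspaceP xA x1]] := rank2_orthogonal one rE.
  by exists x.
have [/eigenvalueP[w wA w0] _] := spectrum_head hlam.
have /eigenvalueP[v vA v0] := ev1.
exists v; split=> //.
apply: (eigenvector_orthogonal_ones sA _ _ w0 wA vA).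
  move=> x /le_t/le_trans; apply; rewrite ler_wpM2r ?dot_ge0 // ltW //.
by rewrite lt_neqAle eq_sym n01.
Qed.

Hypothesis A_ge0 : forall i j, 0 <= A i j.

Lemma gram_spectra th s : 0 < th -> psd (spherical_gram A th s) ->
  (\rank (spherical_gram A th s) <= d)%N ->
  mu`_0 = lam`_1 /\
  subn (count (pred1 lam`_1) lam) (nat_of_bool (lam`_0 == lam`_1))
     = count (pred1 lam`_1) mu.
Proof.
set G := spherical_gram A th s => th0 pG rG; have thn0 : th != 0 by rewrite gt_eqF.
have sG : G^T = G by exact: spherical_gram_sym.
have le_th x : dot x one = 0 -> dot (x *m A) x <= th * dot x x.
  move=> x1; have := pG x.
  by rewrite mulmx_spherical_gram x1 mulr0 scale0r addr0 !dotl subr_ge0.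
have kerG x : dot x one = 0 -> x *m G = 0 -> x *m A = th *: x.
  rewrite mulmx_spherical_gram => ->; rewrite mulr0 scale0r addr0.
  by move/eqP; rewrite subr_eq0 => /eqP.
have rk : (1 < \rank (kermx G))%N by rewrite mxrank_ker; lia.
have [v [v0 /sub_kermxP vG v1]] := rank2_orthogonal one rk.
have vA := kerG v v1 vG; have vB := eigen_proj_conj v1 vA.
have [/eigenvalueP[z zB z0] mu_le] := spectrum_head hmu.
have muE : mu`_0 = th.
  apply/eqP; rewrite eq_le; apply/andP; split; last first.
    by apply: mu_le; rewrite (mem_spectrum _ hmu); apply/eigenvalueP; exists v.
  rewrite leNgt; apply/negP => thmu.
  have z1 : dot z one = 0.
    by apply: proj_conj_eigen_ones zB; rewrite gt_eqF // (lt_trans th0).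
  have := le_th z z1; rewrite -dot_proj_conj // zB dotZl ler_pM2r ?dot_gt0 //.
  by rewrite leNgt thmu.
have thlam : th \in lam.
  by rewrite (mem_spectrum _ hlam); apply/eigenvalueP; exists v.
(* For the harder inclusion, a [th]-eigenvector of [P A P] is isotropic for [G], hence killed by
   [G]. *)
have EPA : (eigenspace B th :=: eigenspace A th :&: kermx one^T)%MS.
  apply/eqmxP/andP; split; apply/rV_subP => x.
    move/eigenspaceP => xB; have x1 := proj_conj_eigen_ones thn0 xB.
    rewrite sub_capmx sub_kermx_dot x1 eqxx andbT.
    apply/eigenspaceP; apply: kerG => //; apply: psd_ker => //.
    rewrite mulmx_spherical_gram x1 mulr0 scale0r addr0 !dotl.
    by rewrite -(dot_proj_conj _ x1) xB dotZl subrr.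
  rewrite sub_capmx sub_kermx_dot => /andP[/eigenspaceP xA /eqP x1].
  by apply/eigenspaceP; exact: eigen_proj_conj.
(* Rank-nullity for [x . one] on the eigenspace of [A]: its rank, 0 or 1, is the multiplicity lost
   in passing to [P A P]. *)
have rEP := mxrank_mul_ker (eigenspace A th) one^T.
rewrite -EPA in rEP.
have EP0 : (0 < \rank (eigenspace B th))%N.
  rewrite lt0n mxrank_eq0; apply: contraNneq v0 => E0.
  by rewrite -submx0 -E0; apply/eigenspaceP.
have lam1_le := second_le_form le_th.
have [_ _ lamP] := spectrum_second hlam.
rewrite muE !(count_rank_eigenspace _ _ hlam, count_rank_eigenspace _ _ hmu) //.
have [th_top|th_ntop] := eqVneq th lam`_0.
  have [u uA u1] : exists2 u : 'rV[R]_n, u *m A = th *: u & dot u one != 0.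
    by apply: perron_ones vA => // x; rewrite th_top form_le_top.
  have r1 : \rank (eigenspace A th *m one^T) = 1%N.
    apply/eqP; rewrite eqn_leq rank_leq_col lt0n mxrank_eq0.
    apply: contraNneq u1 => /sub_kermxP kE; rewrite -sub_kermx_dot.
    by apply: submx_trans kE; apply/eigenspaceP.
  rewrite r1 in rEP.
  (* The eigenspace of [A] has one dimension more than a nonzero space, so the top eigenvalue is
     multiple. *)
  have e01 : lam`_0 == lam`_1.
    rewrite -(spectrum_top_multiple hlam) (count_rank_eigenspace _ sA hlam).
    by rewrite -th_top -rEP.
  by rewrite e01 -(eqP e01) -th_top; split=> //; rewrite -rEP addKn.
have {lamP}[e|le_th1] := lamP _ thlam; first by rewrite e eqxx in th_ntop.
have thE : th = lam`_1 by apply: le_anti; rewrite le_th1.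
have th_lt : th < lam`_0 by rewrite lt_neqAle th_ntop; case: (spectrum_head hlam) => _; exact.
rewrite -thE eq_sym (negPf th_ntop) subn0; split=> //.
have [/eigenvalueP[w wA w0] _] := spectrum_head hlam.
rewrite -rEP; apply/eqP; rewrite -[X in _ == X]add0n eqn_add2r mxrank_eq0.
apply/eqP/sub_kermxP; apply/rV_subP => x /eigenspaceP xA.
by rewrite sub_kermx_dot (eigenvector_orthogonal_ones sA le_th th_lt w0 wA xA).
Qed.

(** * From the spectral conditions to a Gram matrix *)

Section Converse.
Hypothesis top : mu`_0 = lam`_1.
Hypothesis multE :
  subn (count (pred1 lam`_1) lam) (nat_of_bool (lam`_0 == lam`_1))
     = count (pred1 lam`_1) mu.

Lemma second_eigen_orthogonal_ones (x : 'rV[R]_n) : lam`_0 != lam`_1 ->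
  x *m A = lam`_1 *: x -> dot x one = 0.
Proof.
move=> n01; have [_ le10 _] := spectrum_second hlam.
have [/eigenvalueP[w wA w0] _] := spectrum_head hlam.
apply: (eigenvector_orthogonal_ones sA _ _ w0 wA).
  by move=> y y1; rewrite -top form_le_proj_top.
by rewrite lt_neqAle eq_sym n01.
Qed.

(* If the common value were [0], the vector [1] would be an extra null vector of
   [P A P]. *)
Lemma proj_top_gt0 : 0 < mu`_0.
Proof.
rewrite lt0r proj_top_ge0 andbT; apply/eqP => mu0.
have l10 : lam`_1 = 0 by rewrite -top.
move: multE; rewrite l10 !(count_rank_eigenspace _ _ hlam, count_rank_eigenspace _ _ hmu) //.
(* If the top eigenvalue of [A] is 0, then [- A] is positive semidefinite; as [A] has nonnegative
   entries, [one] is isotropic for [- A], so [A] kills [one]. *)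
have [l00|n00] := eqVneq lam`_0 0.
  have oA : one *m A = 0.
    apply/eqP; rewrite -oppr_eq0 -mulmxN; apply/eqP; apply: psd_ker.
    - by rewrite linearN /= sA.
    - by move=> x; rewrite mulmxN dotNl oppr_ge0 (le_trans (form_le_top x)) // l00 mul0r.
    apply/eqP; rewrite mulmxN dotNl oppr_eq0 eq_le.
    rewrite (le_trans (form_le_top _)) ?l00 ?mul0r //=.
    rewrite dotE sumr_ge0 // => i _; rewrite !mxE mulr1 sumr_ge0 // => j _.
    by rewrite !mxE mul1r.
  have sub : (eigenspace A 0 <= eigenspace B 0)%MS.
    apply/rV_subP => x /eigenspaceP; rewrite scale0r => xA.
    apply/eigenspaceP; rewrite !mulmxA (mulmx_proj_ones x) mulmxBl xA -scalemxAl oA.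
    by rewrite scaler0 subr0 mul0mx scale0r.
  (* Positivity rules out truncation in the natural-number subtraction, so the multiplicity really
     drops, against [sub]. *)
  have E0 : (0 < \rank (eigenspace A 0))%N.
    rewrite lt0n mxrank_eq0; apply/eqP => E0.
    have : (one <= eigenspace A 0)%MS by apply/eigenspaceP; rewrite oA scale0r.
    by rewrite E0 submx0 -dot_eq0 gt_eqF // dot_ones_gt0.
  have := mxrankS sub; rewrite /=; move: E0.
  by move: (\rank _) (\rank _) => p q ? ? ?; lia.
have n01 : lam`_0 != lam`_1 by rewrite l10.
(* Null vectors of [A] are orthogonal to [one], so [one] is a null vector of [P A P] but not of [A],
   and the multiplicities differ. *)
have sub : (eigenspace A 0 < eigenspace B 0)%MS.
  apply/andP; split.
    apply/rV_subP => x /eigenspaceP xA; apply/eigenspaceP.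
    apply: eigen_proj_conj => //; apply: second_eigen_orthogonal_ones => //.
    by rewrite l10.
  apply/negP => /(submx_trans _) sub.
  have /sub/eigenspaceP oA : (one <= eigenspace B 0)%MS.
    by apply/eigenspaceP; rewrite ones_proj_conj scale0r.
  have := @second_eigen_orthogonal_ones one n01; rewrite l10 => /(_ oA) /eqP.
  by rewrite gt_eqF // dot_ones_gt0.
by have := rank_ltmx sub; rewrite subn0 => + e; rewrite e ltnn.
Qed.

Lemma spectra_gram : exists s, psd (spherical_gram A mu`_0 s) /\
  (\rank (spherical_gram A mu`_0 s) <= d)%N.
Proof.
have th0 := proj_top_gt0; have thn0 : mu`_0 != 0 by rewrite gt_eqF.
move: multE; rewrite !(count_rank_eigenspace _ _ hlam, count_rank_eigenspace _ _ hmu) //.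
rewrite -top.
have [e01|n01] := eqVneq lam`_0 mu`_0.
  move=> _; exists 0; split.
    move=> x; rewrite mulmx_spherical_gram mul0r scale0r addr0 !dotl subr_ge0.
    by rewrite -e01 form_le_top.
  have : (1 < count (pred1 (mu`_0)%R) lam)%N.
    by rewrite -e01 (spectrum_top_multiple hlam) e01 top.
  have -> : spherical_gram A mu`_0 0 = - (A - (mu`_0)%:M).
    by rewrite /spherical_gram scale0r addr0 opprB.
  rewrite mxrank_opp; have := symmx_multiplicity mu`_0 sA (proj2 hlam).
  by move: (\rank _) (count _ _) => p q; lia.
rewrite subn0 => rE; have n01' : lam`_0 != lam`_1 by rewrite -top.
have E1 x : x *m A = mu`_0 *: x -> dot x one = 0.
  by rewrite top; exact: second_eigen_orthogonal_ones.
have EAP : (eigenspace A mu`_0 <= eigenspace B mu`_0)%MS.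
  apply/rV_subP => x /eigenspaceP xA; apply/eigenspaceP.
  by apply: eigen_proj_conj => //; exact: E1.
have EPA : (eigenspace B mu`_0 <= eigenspace A mu`_0)%MS.
  by rewrite -(geq_leqif (mxrank_leqif_sup EAP)) rE.
pose N := (mu`_0)%:M - A.
have NE x : x *m N = mu`_0 *: x - x *m A by rewrite mulmxBr mul_mx_scalar.
have sN : N^T = N by rewrite linearB /= tr_scalar_mx sA.
have [u uN] : exists u, u *m N = one.
  apply: symmx_orthogonal_ker => //; apply/rV_subP => x /sub_kermxP.
  rewrite NE sub_kermx_dot => /eqP; rewrite subr_eq0 => /eqP xA.
  by rewrite E1.
have uA : u *m A = mu`_0 *: u - one by rewrite -uN NE opprB addrC subrK.
have one0 : one != 0 by rewrite -dot_gt0 dot_ones_gt0.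
(* Otherwise [u] would lie in the eigenspace of [P A P], hence in that of [A], and [u N] would be 0
   instead of [one]. *)
have u1 : dot u one != 0.
  apply: contra one0 => /eqP u1.
  have /submx_trans/(_ EPA)/eigenspaceP uA' : (u <= eigenspace B mu`_0)%MS.
    apply/eigenspaceP; rewrite mulmx_proj_conj // uA mulmxBl ones_proj_ones.
    by rewrite subr0 -scalemxAl mulmx_proj_ones_id.
  by rewrite -uN NE uA' subrr.
(* This choice gives [u G = one + s (u . one) one = 0]. *)
pose s := - (dot u one)^-1; exists s; set G := spherical_gram _ _ _.
have sG : G^T = G by exact: spherical_gram_sym.
have GE x : x *m G = x *m N + (s * dot x one) *: one.
  by rewrite mulmx_spherical_gram NE.
have uG : u *m G = 0.
  by rewrite GE uN /s mulNr mulVf // scaleN1r subrr.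
split.
  (* Subtracting a multiple of the kernel vector [u] moves [x] into the complement of [one], where
     [G] and [N] have the same form. *)
  move=> x; pose t := dot x one / dot u one.
  have [y yE] : exists y, y = x - t *: u by exists (x - t *: u).
  have y1 : dot y one = 0 by rewrite yE !dotl /t divfK // subrr.
  have -> : x = y + t *: u by rewrite yE subrK.
  rewrite mulmxDl -scalemxAl uG scaler0 addr0 dot_symmx // mulmxDl -scalemxAl uG.
  rewrite scaler0 addr0 GE y1 mulr0 scale0r addr0 NE !dotl subr_ge0.
  exact: form_le_proj_top.
(* [u] is in the kernel of [G] but not in the eigenspace, which is orthogonal to [one]; that
   eigenspace being nonzero, the kernel has dimension at least 2. *)
have sub : (eigenspace A mu`_0 < kermx G)%MS.
  apply/andP; split.
    apply/rV_subP => x /eigenspaceP xA; apply/sub_kermxP.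
    by rewrite GE NE xA (E1 _ xA) mulr0 scale0r addr0 subrr.
  apply: contra u1 => /(submx_trans _) sub.
  by apply/eqP/E1; apply/eigenspaceP/sub/sub_kermxP.
have EA0 : (0 < \rank (eigenspace A mu`_0))%N.
  rewrite rE lt0n mxrank_eq0.
  by case: (spectrum_head hmu).
have := rank_ltmx sub; rewrite mxrank_ker; move: EA0.
by move: (\rank _) (\rank _) => p q; lia.
Qed.

End Converse.
End SpectralCriterion.

Theorem theorem1p1 (R : realType) (d : nat) (hd : (0 < d)%N)
  (e : rel 'I_d.+2) (hG : simple_graph e)
  (lam mu : seq R)
  (hlam : spectrum_desc (adj_mx R e) lam)
  (hmu : spectrum_desc (proj_ones R d.+2 *m adj_mx R e *m proj_ones R d.+2) mu) :
  spherical_rep R d e <->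
  (mu`_0 = lam`_1 /\
   subn (count (pred1 lam`_1) lam) (nat_of_bool (lam`_0 == lam`_1))
     = count (pred1 lam`_1) mu).
Proof.
have [eS eI] := hG.
have sA : (adj_mx R e)^T = adj_mx R e by apply/matrixP => i j; rewrite !mxE eS.
have A_ge0 i j : 0 <= adj_mx R e i j by rewrite mxE ler0n.
split=> [/(spherical_rep_gram hG)[th [s [th0 pG rG]]]|[top multE]].
  exact: gram_spectra pG rG.
have th0 := proj_top_gt0 sA hlam hmu A_ge0 top multE.
have [s [pG rG]] := spectra_gram sA hlam hmu A_ge0 top multE.
have [/eigenvalueP[x xB x0] _] := spectrum_head hmu.
apply: gram_spherical_rep pG rG => //.
  (* Without edges [A = 0], and the top eigenvalue of [P A P] would be 0. *)
  suff /existsP[i /existsP[j eij]] : [exists i, exists j, e i j] by exists i, j.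
  apply: contraTT th0 => /existsPn e0; rewrite -leNgt.
  have A0 : adj_mx R e = 0.
    apply/matrixP => i j; rewrite !mxE.
    by have /existsPn/(_ j)/negPf-> := e0 i.
  move: xB; rewrite A0 mulmx0 mul0mx mulmx0 => /esym/eqP.
  by rewrite scaler_eq0 (negPf x0) orbF => /eqP->.
have x1 : dot x (const_mx 1) = 0.
  by apply: proj_conj_eigen_ones xB; rewrite gt_eqF.
(* For a complete graph [A = J - I] acts as [-1] on the complement of [one], so the top eigenvalue
   would be [-1]. *)
have : [exists i, exists j, (i != j) && ~~ e i j].
  apply: contraTT th0 => /existsPn e1; rewrite -leNgt.
  have xA : x *m adj_mx R e = - x.
    have -> : adj_mx R e = const_mx 1 - 1%:M.
      apply/matrixP => i j; rewrite !mxE; have [->|ij] := eqVneq i j.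
        by rewrite eI subrr.
      have /existsPn/(_ j) := e1 i; rewrite ij negbK => ->.
      by rewrite subr0.
    by rewrite mulmxBr mulmx1 mulmx_ones x1 scale0r sub0r.
  move: xB; rewrite mulmx_proj_conj // xA mulNmx mulmx_proj_ones_id //.
  move/eqP; rewrite -scaleN1r -subr_eq0 -scalerBl scaler_eq0 (negPf x0) orbF.
  by rewrite subr_eq0 => /eqP <-; rewrite lerN10.
by case/existsP => i /existsP[j /andP[ij eij]]; exists i, j.
Qed.
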